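(* Let $d\ge 1$ and let $(\mathbf X_t)_{t\ge0}$ be a stationary random walk Metropolis--Hastings (RWMH) chain on $\mathbb R^d$ with target density $\pi$ and proposal step-density $\phi$ (both with respect to Lebesgue measure). If $\mathbf X_0\in L^2$, then $$\operatorname{trCorr}(\mathbf X_0,\mathbf X_1)>0.$$
   Context: RWMH chain: $\pi$ and $\phi$ are probability densities on $\mathbb R^d$ with respect to Lebesgue measure, with no further conditions. Set $q(\mathbf x,\mathbf y)=\phi(\mathbf y-\mathbf x)$ and $$\alpha(\mathbf x,\mathbf y)=\begin{cases}\min\{1,\ \pi(\mathbf y)q(\mathbf y,\mathbf x)/(\pi(\mathbf x)q(\mathbf x,\mathbf y))\},&\pi(\mathbf x)q(\mathbf x,\mathbf y)>0,\\ 1,&\pi(\mathbf x)q(\mathbf x,\mathbf y)=0.\end{cases}$$ From state $\mathbf x$, the Markov chain proposes $\mathbf y$ drawn from the density $q(\mathbf x,\cdot)$, moves to $\mathbf y$ with probability $\alpha(\mathbf x,\mathbf y)$, and otherwise stays at $\mathbf x$. The chain is stationary: $\mathbf X_0$ (hence every $\mathbf X_t$) has density $\pi$. No irreducibility is assumed. $\mathbf X_0\in L^2$ means $\mathbb E\|\mathbf X_0\|^2<\infty$ (Euclidean norm). For random vectors $\mathbf Y,\tilde{\mathbf Y}\in L^2$ in $\mathbb R^d$: $\operatorname{trCov}(\mathbf Y,\tilde{\mathbf Y})=\sum_{i=1}^d\operatorname{Cov}(Y_i,\tilde Y_i)$, $\operatorname{trVar}\mathbf Y=\operatorname{trCov}(\mathbf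 Y,\mathbf Y)$, and, when neither vector is degenerate, $\operatorname{trCorr}(\mathbf Y,\tilde{\mathbf Y})=\operatorname{trCov}(\mathbf Y,\tilde{\mathbf Y})/\big((\operatorname{trVar}\mathbf Y)^{1/2}(\operatorname{trVar}\tilde{\mathbf Y})^{1/2}\big)$. *)

(* Defs.v *)
From HB Require Import structures.
From mathcomp Require Import all_boot all_order all_algebra.
From mathcomp Require Import all_classical all_reals all_analysis.

Set Implicit Arguments.
Unset Strict Implicit.
Unset Printing Implicit Defensive.
Import Order.TTheory GRing.Theory Num.Theory.
Import numFieldNormedType.Exports.

Local Open Scope classical_set_scope.
Local Open Scope ring_scope.
Local Open Scope ereal_scope.

(* R^d is d.-tuple R, whose library sigma-algebra, generated by the
   coordinates, is the Borel one. *)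

Section lebesgue_vec.
Context (R : realType).

Definition vec_cons n (p : measurableTypeR R * n.-tuple R) : n.+1.-tuple R :=
  [the n.+1.-tuple R of p.1 :: p.2].

Lemma measurable_vec_cons n : measurable_fun setT (@vec_cons n).
Proof.
apply: measurable_cons; last exact: measurable_snd.
exact: (@measurable_fst _ _ (measurableTypeR R)).
Qed.

Section step.
Context n (mu : {sigma_finite_measure set (n.-tuple R) -> \bar R}).

Definition lebesgue_vecS : set (n.+1.-tuple R) -> \bar R :=
  pushforward (lebesgue_measure \x mu) (@vec_cons n).

Let mpre A : measurable A -> measurable (@vec_cons n @^-1` A).
Proof.
by move=> mA; rewrite -[X in measurable X]setTI; exact: measurable_vec_cons.
Qed.

Let lebesgue_vecS0 : lebesgue_vecS set0 = 0.
Proof. by rewrite /lebesgue_vecS /pushforward preimage_set0 measure0. Qed.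

Let lebesgue_vecS_ge0 A : 0 <= lebesgue_vecS A.
Proof. exact: (measure_ge0 (lebesgue_measure \x mu)). Qed.

Let lebesgue_vecS_sigma_additive : semi_sigma_additive lebesgue_vecS.
Proof.
move=> F mF tF mUF; rewrite /lebesgue_vecS /pushforward preimage_bigcup.
apply: measure_semi_sigma_additive.
- by move=> i; exact: mpre.
- apply/trivIsetP => /= i j _ _ ij; rewrite -preimage_setI.
  by move/trivIsetP : tF => /(_ _ _ _ _ ij) ->//; rewrite preimage_set0.
- by rewrite -preimage_bigcup; exact: mpre.
Qed.

HB.instance Definition _ := isMeasure.Build _ _ _ lebesgue_vecS
  lebesgue_vecS0 lebesgue_vecS_ge0 lebesgue_vecS_sigma_additive.

Let sigma_finite_lebesgue_vecS : sigma_finite setT lebesgue_vecS.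
Proof.
pose leb : {sigma_finite_measure set (measurableTypeR R) -> \bar R} :=
  lebesgue_measure.
have /sigma_finiteP[F [FT ndF Foo]] := sigma_finiteT leb.
have /sigma_finiteP[G [GT ndG Goo]] := sigma_finiteT mu.
pose tl (t : n.+1.-tuple R) : n.-tuple R := [tuple of behead t].
have tlE x t : tl (vec_cons (x, t)) = t by apply/val_inj.
pose H i : set (n.+1.-tuple R) :=
  (@thead n R @^-1` F i) `&` (tl @^-1` G i).
exists H => [|i].
  apply/esym/seteqP; split=> // t _.
  have [i _ Fi] : (\bigcup_i F i) (thead t) by rewrite -FT.
  have [j _ Gj] : (\bigcup_i G i) (tl t) by rewrite -GT.
  exists (maxn i j) => //; split => /=.
    by move: Fi; exact/subsetPset/ndF/leq_maxl.
  by move: Gj; exact/subsetPset/ndG/leq_maxr.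
have [mF Fioo] := Foo i; have [mG Gioo] := Goo i; split.
  apply: measurableI; rewrite -[X in measurable X]setTI.
    exact: (measurable_tnth (ord0 : 'I_n.+1)).
  exact: measurable_behead.
rewrite /lebesgue_vecS /pushforward (_ : _ @^-1` H i = F i `*` G i).
  by rewrite product_measure1E// lte_mul_pinfty// ge0_fin_numE.
by apply/seteqP; split=> -[x t]; rewrite /H /= tlE.
Qed.

HB.instance Definition _ := Measure_isSigmaFinite.Build _ _ _
  lebesgue_vecS sigma_finite_lebesgue_vecS.

End step.

Fixpoint lebesgue_vec n : {sigma_finite_measure set (n.-tuple R) -> \bar R} :=
  if n is m.+1 then lebesgue_vecS (lebesgue_vec m) else \d_[tuple].

End lebesgue_vec.

(* This determines lebesgue_vec among sigma-finite measures. *)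
Lemma lebesgue_vec_box (R : realType) n (A : 'I_n -> set R) :
  (forall i, measurable (A i)) ->
  lebesgue_vec R n [set t | forall i, A i (tnth t i)] =
  \prod_(i < n) lebesgue_measure (A i).
Proof.
elim: n A => [|n IHn] A mA.
  by rewrite big_ord0 /= diracE mem_set//= => -[].
pose B i := A (lift ord0 i).
have mB : measurable [set t : n.-tuple R | forall i, B i (tnth t i)].
  rewrite (_ : [set _ | _] = \bigcap_(i : 'I_n) (@tnth n R ^~ i @^-1` B i)).
    apply: fin_bigcap_measurable => // i _; rewrite -[X in measurable X]setTI.
    by apply: measurable_tnth => //; exact: mA.
  by apply/seteqP; split=> t /= Bt i; [move=> _|]; exact: Bt.
rewrite big_ord_recl -(IHn B) => [|i]; last exact: mA.
rewrite [LHS](_ : _ = (lebesgue_measure \x lebesgue_vec R n)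
    (A ord0 `*` [set t | forall i, B i (tnth t i)])).
  by rewrite product_measure1E//; exact: mA.
rewrite /= /lebesgue_vecS /pushforward; congr (_ _).
apply/seteqP; split=> -[x t] /=.
  move=> At; split; first exact: (At ord0).
  by move=> i; have := At (lift ord0 i); rewrite tnthS.
move=> [Ax Bt] i; case: (unliftP ord0 i) => [j|] ->//.
by rewrite tnthS; exact: Bt.
Qed.

Section rwmh.
Context (R : realType) (d : nat).
Implicit Types (f target step : d.-tuple R -> R) (x y : d.-tuple R).

Definition probability_density f :=
  [/\ measurable_fun setT f, forall x, (0 <= f x)%R &
      \int[lebesgue_vec R d]_x (f x)%:E = 1].

Definition vec_sub y x : d.-tuple R := [tuple (tnth y i - tnth x i)%R | i < d].

Definition proposal step x y : R := step (vec_sub y x).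

Definition acceptance target step x y : R :=
  if (0 < target x * proposal step x y)%R then
    Num.min 1%R (target y * proposal step y x / (target x * proposal step x y))%R
  else 1%R.

(* Propose y from the density proposal step x; the next state is y with
   probability acceptance target step x y, and x otherwise. *)
Definition rwmh_kernel target step x (B : set (d.-tuple R)) : \bar R :=
  \int[lebesgue_vec R d]_y
    (proposal step x y *
       (acceptance target step x y * \1_B y +
        (1 - acceptance target step x y) * \1_B x))%:E.

End rwmh.

(* P[X_{t+1} \in B | X_0, ..., X_t] = k X_t B almost surely, written out with
   the defining property of conditional probability. *)
Definition markov_chain (R : realType) dO (Omega : measurableType dO)
    (P : probability Omega R) dT (T : measurableType dT)
    (k : T -> set T -> \bar R) (X : nat -> {RV P >-> T}) :=
  forall (t : nat) (H : set Omega) (B : set T),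
    g_sigma_preimage (fun s : 'I_t.+1 => X s : Omega -> T) H -> measurable B ->
    P (H `&` X t.+1 @^-1` B) = \int[P]_(w in H) k (X t w) B.

Section random_vectors.
Context (R : realType) (d : nat) dO (Omega : measurableType dO)
  (P : probability Omega R).
Implicit Types Y : {RV P >-> d.-tuple R}.

Definition has_density Y (f : d.-tuple R -> R) :=
  forall A, measurable A ->
    distribution P Y A = \int[lebesgue_vec R d]_(x in A) (f x)%:E.

Definition eucl_norm (x : d.-tuple R) : R :=
  Num.sqrt (\sum_(i < d) tnth x i ^+ 2)%R.

Definition square_integrable Y := 'E_P[fun w => eucl_norm (Y w) ^+ 2]%R < +oo.

Definition coord Y (i : 'I_d) : Omega -> R := fun w => tnth (Y w) i.

Definition trCov Y Y' : \bar R :=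
  \sum_(i < d) covariance P (coord Y i) (coord Y' i).

Definition trVar Y : \bar R := trCov Y Y.

(* Division by zero being zero, this is 0 if Y or Y' is degenerate; hence
   0 < trCorr Y Y' includes that neither is. *)
Definition trCorr Y Y' : R :=
  (fine (trCov Y Y') /
   (Num.sqrt (fine (trVar Y)) * Num.sqrt (fine (trVar Y'))))%R.

End random_vectors.

Definition stationary_rwmh (R : realType) (d : nat) dO
    (Omega : measurableType dO) (P : probability Omega R)
    (target step : d.-tuple R -> R) (X : nat -> {RV P >-> d.-tuple R}) :=
  has_density (X 0%N) target /\ markov_chain (rwmh_kernel target step) X.

(* Main.v *)
Require Import Defs.
From HB Require Import structures.
From mathcomp Require Import all_boot all_order all_algebra.
From mathcomp Require Import all_classical all_reals all_analysis.
From mathcomp Require Import measurable_realfun ring lra.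

(** Write [c] for the mean of the target density [pi].  By polarization and
    stationarity,
      2 trCov(X_0, X_1) = 2 E|X_0 - c|^2 - E|X_1 - X_0|^2,
    so the correlation is positive as soon as the mean squared jump is smaller
    than twice the variance.  This also shows that the variance is positive.

    Rejected proposals do not contribute to the jump, and accepted ones go from
    [x] to [y] with density [min (pi x * phi (y - x)) (pi y * phi (x - y))]
    (lemmas [target_proposal_acceptance] and [ge0_integral_joint]).  Substitute
    [y = x - h], exchange the integrals, and fix [h], with [a = phi (- h)] and
    [b = phi h].  Since [a + b] integrates to 2 over [h], it is enough to prove
    (lemma [overlap_lt]), for [h <> 0] and [a + b > 0],
      |h|^2 int min (a * pi x) (b * pi (x - h)) dx
        < (a + b) int pi x |x - c|^2 dx.

    This is a statement about the chords from [x - h] to [x].  A chord carries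
    the mass [m = min (a * pi x) (b * pi (x - h))], which is at most [a] times
    the density at its right end [x] and at most [b] times the density at its
    left end.  Let [t] and [t - k], with [k = |h|^2], be the scalar products
    with [h] of the two ends relative to [c].  The right end is charged only if
    [t > 0], and the left end only if [t < k].  If the chord crosses the
    hyperplane through [c] orthogonal to [h], both ends are charged, and
    t^2 / a + (k - t)^2 / b >= k^2 / (a + b) by Cauchy-Schwarz; otherwise the
    far end pays for the chord alone (lemma [chord_le]).  A given point is then
    charged at most once, as a right end or as a left end according to the side
    of the hyperplane on which it lies, which yields the constant [a + b] rather
    than its double.

    Equality would force almost every charged end to belong to a chord with
    [(a + b) * t = a * k] (lemma [chord_lt]).  The right ends of these chords
    lie on one hyperplane and their left ends on another, and hyperplanes are null
    sets; but [pi] has positive mass off the hyperplane through [c], where every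
    point is charged.  So the inequality is strict. *)

Set Implicit Arguments.
Unset Strict Implicit.
Unset Printing Implicit Defensive.
Import Order.TTheory GRing.Theory Num.Theory.
Import numFieldNormedType.Exports.

Local Open Scope classical_set_scope.
Local Open Scope ring_scope.

(** * Integrals and measures *)

Section integral_lemmas.
Local Open Scope ereal_scope.

(** The equality case of the monotonicity of the integral: the integral of the
    nonnegative function [g - f] vanishes. *)
Lemma ge0_integral_squeeze_ae d0 (T : measurableType d0) (R : realType)
    (mu : {measure set T -> \bar R}) (f g : T -> R) :
  measurable_fun setT f -> measurable_fun setT g ->
  (forall x, 0 <= f x <= g x)%R -> \int[mu]_x (g x)%:E < +oo ->
  \int[mu]_x (g x)%:E <= \int[mu]_x (f x)%:E -> {ae mu, forall x, f x = g x}.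
Proof.
move=> mf mg fg goo gf.
have f0 x : (0 <= f x)%R by case/andP: (fg x).
have fleg x : (f x <= g x)%R by case/andP: (fg x).
have dg x : (0 <= g x - f x)%R by rewrite subr_ge0.
have md : measurable_fun setT (fun x => g x - f x)%R by exact: measurable_funB.
have ffin : \int[mu]_x (f x)%:E \is a fin_num.
  rewrite ge0_fin_numE; last by apply: integral_ge0 => x _; rewrite lee_fin.
  apply: le_lt_trans goo; apply: ge0_le_integral => //.
  - by move=> x _; rewrite lee_fin.
  - exact/measurable_EFinP.
  - exact/measurable_EFinP.
  - by move=> x _; rewrite lee_fin.
have d0' : \int[mu]_x (g x - f x)%:E = 0.
  apply/eqP; rewrite eq_le integral_ge0 ?andbT; last first.
    by move=> x _; rewrite lee_fin.
  rewrite -(leeD2rE _ _ ffin) add0e -ge0_integralD//.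
  - by under eq_integral do rewrite -EFinD subrK.
  - by move=> x _; rewrite lee_fin.
  - exact/measurable_EFinP.
  - by move=> x _; rewrite lee_fin.
  - exact/measurable_EFinP.
have : ae_eq mu setT (fun x => (g x - f x)%:E) (cst 0).
  apply/ae_eq_integral_abs => //; first exact/measurable_EFinP.
  by under eq_integral do rewrite gee0_abs ?lee_fin//.
apply: filterS => x /(_ I) [] /eqP; rewrite subr_eq0 => /eqP //.
Qed.

Lemma ge0_integral0_ae d0 (T : measurableType d0) (R : realType)
    (mu : {measure set T -> \bar R}) (f : T -> R) :
  measurable_fun setT f -> (forall x, 0 <= f x)%R ->
  \int[mu]_x (f x)%:E = 0 -> {ae mu, forall x, f x = 0%R}.
Proof.
move=> mf f0 if0.
have zf x : (0 <= (cst 0 x : R) <= f x)%R by rewrite lexx f0.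
have := ge0_integral_squeeze_ae (measurable_cst _) mf zf.
move=> /(_ mu); rewrite if0 => /(_ (ltry _)).
rewrite integral_ge0// => /(_ isT).
by apply: filterS => x <-.
Qed.

Lemma ae0_ge0_integral d0 (T : measurableType d0) (R : realType)
    (mu : {measure set T -> \bar R}) (f : T -> R) :
  measurable_fun setT f -> (forall x, 0 <= f x)%R ->
  {ae mu, forall x, f x = 0%R} -> \int[mu]_x (f x)%:E = 0.
Proof.
move=> mf f0 aef0.
rewrite (ge0_ae_eq_integral (g := cst 0))//.
- by rewrite integral_cst// mul0e.
- exact/measurable_EFinP.
- by move=> x _; rewrite lee_fin.
- by apply: filterS aef0 => x -> _.
Qed.

Lemma integral_indic_mul d (T : measurableType d) (R : realType)
    (mu : {measure set T -> \bar R}) (A : set T) (f : T -> \bar R) :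
  \int[mu]_(x in A) f x = \int[mu]_x (f x * (\1_A x)%:E).
Proof.
rewrite integral_mkcond; apply: eq_integral => x _.
by rewrite epatch_indic.
Qed.

(** Rectangles are stable under intersection and generate the product
    sigma-algebra. *)
Lemma finite_measure_eq_rect d1 d2 (T1 : measurableType d1)
    (T2 : measurableType d2) (R : realType)
    (m1 m2 : {measure set (T1 * T2) -> \bar R}) :
  m1 setT < +oo ->
  (forall A B, measurable A -> measurable B -> m1 (A `*` B) = m2 (A `*` B)) ->
  forall X, measurable X -> m1 X = m2 X.
Proof.
move=> m1fin m12 X mX.
pose C : set (set (T1 * T2)) :=
  [set A `*` B | A in measurable & B in measurable].
apply: (measure_unique C (fun=> setT)) => //.
- exact: measurable_prod_measurableType.
- move=> _ _ [A1 mA1 [B1 mB1 <-]] [A2 mA2 [B2 mB2 <-]]; rewrite -setXI.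
  exists (A1 `&` A2); first exact: measurableI.
  by exists (B1 `&` B2) => //; exact: measurableI.
- by move=> _; exists setT => //; exists setT => //; rewrite setXTT.
- by rewrite bigcup_const//; exists 0%N.
- by move=> _ [A mA [B mB <-]]; exact: m12.
Qed.

End integral_lemmas.

Section density_measure.
Local Open Scope ereal_scope.
Context d (T : measurableType d) (R : realType).
Variable mu : {measure set T -> \bar R}.
Variable w : T -> R.

(** The two proofs are arguments of the definition so that the measure structure
    can be inferred from [mdensity mw w0] alone. *)
Definition mdensity (mw : measurable_fun setT w) (w0 : forall x, (0 <= w x)%R)
  (A : set T) : \bar R := \int[mu]_(x in A) (w x)%:E.

Hypotheses (mw : measurable_fun setT w) (w0 : forall x, (0 <= w x)%R).
Local Notation nu := (mdensity mw w0).

Let mwE : measurable_fun setT (EFin \o w). Proof. exact/measurable_EFinP. Qed.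

Let mdensity0 : nu set0 = 0. Proof. exact: integral_set0. Qed.

Let mdensity_ge0 A : 0 <= nu A.
Proof. by apply: integral_ge0 => x _; rewrite lee_fin. Qed.

Let mdensity_sigma_additive : semi_sigma_additive nu.
Proof.
move=> F mF tF mUF; rewrite /mdensity ge0_integral_bigcup//.
- by apply: is_cvg_ereal_nneg_natsum => k _; exact: mdensity_ge0.
- exact: measurable_funTS.
- by move=> x _; rewrite lee_fin.
Qed.

HB.instance Definition _ := isMeasure.Build _ _ _ nu
  mdensity0 mdensity_ge0 mdensity_sigma_additive.

Import HBNNSimple.

Lemma ge0_integral_mdensity D (f : T -> \bar R) :
  measurable D -> measurable_fun D f -> (forall x, 0 <= f x) ->
  \int[nu]_(x in D) f x = \int[mu]_(x in D) (f x * (w x)%:E).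
Proof.
move=> mD mf f0; pose h := nnsfun_approx mD mf.
have mh n : measurable_fun D (EFin \o h n).
  by apply/measurable_EFinP/measurable_funTS/measurable_funP.
have h_homo x : {homo (fun n => (h n x)%:E) : m n / (m <= n)%N >-> m <= n}.
  by move=> m n mn; rewrite lee_fin; exact/lefP/nd_nnsfun_approx.
have -> : \int[nu]_(x in D) f x = limn (fun n => \int[nu]_(x in D) (h n x)%:E).
  rewrite -monotone_convergence//.
  - apply: eq_integral => x /[!inE] Dx; apply/esym/cvg_lim => //.
    exact: cvg_nnsfun_approx.
  - by move=> n x _; rewrite lee_fin.
have -> : \int[mu]_(x in D) (f x * (w x)%:E) =
    limn (fun n => \int[mu]_(x in D) ((h n x)%:E * (w x)%:E)).
  rewrite -monotone_convergence//.
  - apply: eq_integral => x /[!inE] Dx; apply/esym/cvg_lim => //.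
    by apply: cvgeZr => //; exact: cvg_nnsfun_approx.
  - move=> n; apply: emeasurable_funM; first exact: mh.
    exact/measurable_funTS/mwE.
  - by move=> n x _; rewrite mule_ge0 ?lee_fin.
  - by move=> x _ m n mn; rewrite lee_wpmul2r ?lee_fin//; exact: h_homo.
(* By monotone convergence it remains to treat simple functions. *)
apply/congr_lim/funext => n.
have hE x : (h n x)%:E =
    \sum_(r \in range (h n)) (r * \1_(h n @^-1` [set r]) x)%:E.
  by rewrite fimfunE -fsumEFin.
have mi r : measurable_fun D (fun x => (r * \1_(h n @^-1` [set r]) x)%:E).
  by apply/measurable_EFinP/measurable_funM.
rewrite (eq_integral _ _ (fun x _ => hE x)).
rewrite ge0_integral_fsum//; last by move=> r x _; exact: nnfun_muleindic_ge0.
rewrite [RHS](eq_integral (fun x => \sum_(r \in range (h n))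
    ((r * \1_(h n @^-1` [set r]) x)%:E * (w x)%:E))); last first.
  move=> x _; rewrite hE ge0_mule_fsuml// => r.
  exact: nnfun_muleindic_ge0.
rewrite ge0_integral_fsum//; last 2 first.
- by move=> r; apply: emeasurable_funM; [exact: mi|exact/measurable_funTS/mwE].
- move=> r x _; apply: mule_ge0; first exact: nnfun_muleindic_ge0.
  by rewrite lee_fin.
apply: eq_fsbigr => r /[!inE] -[t _ <-].
rewrite integralZl_indic_nnsfun// integral_indic//=.
under [RHS]eq_integral do rewrite EFinM -muleA.
rewrite ge0_integralZl//; last 3 first.
- apply: emeasurable_funM; first exact/measurable_EFinP.
  exact/measurable_funTS/mwE.
- by move=> x _; rewrite mule_ge0 ?lee_fin.
- by rewrite lee_fin.
congr (_ * _); rewrite /mdensity setIC integral_mkcondr.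
by apply: eq_integral => x _; rewrite epatch_indic/= muleC.
Qed.

End density_measure.

(** * Symmetries and null sets of Lebesgue measure on R^d *)

Section lebesgue_reflection.
Local Open Scope ereal_scope.
Context (R : realType).
Local Notation leb := (@lebesgue_measure R).

Let reflect (c : R) :=
  fun x : measurableTypeR R => (c - x)%R : measurableTypeR R.

Lemma measurable_reflect (c : R) : measurable_fun setT (reflect c).
Proof. exact: measurable_funB. Qed.

Lemma lebesgue_measure_reflect (c : R) (A : set (measurableTypeR R)) :
  measurable A -> pushforward leb (reflect c) A = leb A.
Proof.
pose mu : {measure set (measurableTypeR R) -> \bar R} :=
  measure_function_pushforward__canonical__measure_function_Measure leb
    (measurable_reflect c).
move=> mA; apply/esym.
apply: (@lebesgue_measure_unique _ mu) => // _ [[a b]] _ <-.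
rewrite /mu/= /pushforward.
rewrite (_ : reflect c @^-1` _ = `[c - b, c - a[%classic)%R.
  rewrite !lebesgue_measure_itv/= !lte_fin ltrD2l ltrN2 -!EFinB.
  by case: ifP => // _; congr (_%:E); ring.
apply/seteqP; split=> x; rewrite /reflect /= !in_itv/= => /andP[? ?];
  by apply/andP; split; lra.
Qed.

Lemma ge0_integral_reflect (c : R) (f : measurableTypeR R -> \bar R) :
  measurable_fun setT f -> (forall x, 0 <= f x) ->
  \int[leb]_x f (c - x)%R = \int[leb]_x f x.
Proof.
move=> mf f0.
have := ge0_integral_pushforward (measurable_reflect c) leb measurableT mf
  (fun x _ => f0 x).
rewrite preimage_setT => <-.
apply: eq_measure_integral; first exact: measurable_reflect.
by move=> mr A mA _; exact: lebesgue_measure_reflect.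
Qed.

End lebesgue_reflection.

Section lebesgue_vec_theory.
Local Open Scope ereal_scope.
Context (R : realType).

Lemma ge0_integral_lebesgue_vecS n (f : n.+1.-tuple R -> \bar R) :
  measurable_fun setT f -> (forall t, 0 <= f t) ->
  \int[lebesgue_vec R n.+1]_t f t =
  \int[lebesgue_measure]_x \int[lebesgue_vec R n]_t f (vec_cons (x, t)).
Proof.
move=> mf f0.
rewrite [LHS](ge0_integral_pushforward (@measurable_vec_cons R n)
  (lebesgue_measure \x lebesgue_vec R n) measurableT mf (fun x _ => f0 x)).
rewrite preimage_setT (fubini_tonelli1 (f \o @vec_cons R n))//.
  by apply: measurableT_comp => //; exact: measurable_vec_cons.
by move=> p; exact: f0.
Qed.

Lemma measurable_vec_sub n d0 (T0 : measurableType d0)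
    (f g : T0 -> n.-tuple R) :
  measurable_fun setT f -> measurable_fun setT g ->
  measurable_fun setT (fun z => vec_sub (f z) (g z)).
Proof.
move=> /measurable_fun_tnthP mf /measurable_fun_tnthP mg.
apply/measurable_fun_tnthP => i.
rewrite (_ : _ \o _ = (fun z => tnth (f z) i - tnth (g z) i)%R); last first.
  by apply/funext => z /=; rewrite tnth_mktuple.
by apply: measurable_funB; [exact: mf|exact: mg].
Qed.

Lemma ge0_integral_vec_reflect n (c : n.-tuple R) (f : n.-tuple R -> \bar R) :
  measurable_fun setT f -> (forall x, 0 <= f x) ->
  \int[lebesgue_vec R n]_x f (vec_sub c x) = \int[lebesgue_vec R n]_x f x.
Proof.
elim: n => [|n IHn] in c f *.
  move=> mf f0; apply: eq_integral => x _.
  by rewrite [vec_sub c x]tuple0 [in RHS](tuple0 x).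
move=> mf f0.
have mfr : measurable_fun setT (fun x => f (vec_sub c x)).
  by apply: (measurableT_comp mf); exact: measurable_vec_sub.
rewrite !ge0_integral_lebesgue_vecS//.
pose F (x : measurableTypeR R) := \int[lebesgue_vec R n]_t f (vec_cons (x, t)).
have mfc : measurable_fun setT (f \o @vec_cons R n).
  by apply: (measurableT_comp mf); exact: measurable_vec_cons.
rewrite -(@ge0_integral_reflect R (thead c) F); last 2 first.
- apply: (measurable_fun_fubini_tonelli_F (f \o @vec_cons R n)) => //.
  by move=> p; exact: f0.
- by move=> x; exact: integral_ge0.
apply: eq_integral => x _; rewrite /F.
rewrite -[RHS](IHn [tuple of behead c]); last 2 first.
- apply: (measurableT_comp mf).
  exact: (measurableT_comp (@measurable_vec_cons R n)
    (@pair1_measurable _ _ (measurableTypeR R) (n.-tuple R) _)).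
- by [].
apply: eq_integral => t _; congr (f _); apply/eq_from_tnth => i.
rewrite tnth_mktuple; case: (unliftP ord0 i) => [j|] ->.
  rewrite !tnthS tnth_mktuple tnth_behead (_ : inord _ = lift ord0 j)//.
  by apply/val_inj; rewrite /= inordK// ltnS.
by rewrite !tnth0.
Qed.

(** The translation by [- h] is the composition of two point reflections. *)
Lemma ge0_integral_vec_translate n (h : n.-tuple R) (f : n.-tuple R -> \bar R) :
  measurable_fun setT f -> (forall x, 0 <= f x) ->
  \int[lebesgue_vec R n]_x f (vec_sub x h) = \int[lebesgue_vec R n]_x f x.
Proof.
move=> mf f0; pose z : n.-tuple R := [tuple 0%R | i < n].
rewrite -[RHS](ge0_integral_vec_reflect (vec_sub z h))//.
rewrite -[RHS](ge0_integral_vec_reflect z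
  (f := fun x => f (vec_sub _ x)))//.
- apply: eq_integral => x _; congr (f _); apply/eq_from_tnth => i.
  by rewrite !tnth_mktuple; ring.
- by apply: (measurableT_comp mf); apply: measurable_vec_sub.
Qed.

Definition vec_dot n (x y : n.-tuple R) : R :=
  (\sum_(i < n) tnth x i * tnth y i)%R.

Lemma measurable_vec_dot n d0 (T0 : measurableType d0)
    (f g : T0 -> n.-tuple R) :
  measurable_fun setT f -> measurable_fun setT g ->
  measurable_fun setT (fun z => vec_dot (f z) (g z)).
Proof.
move=> /measurable_fun_tnthP mf /measurable_fun_tnthP mg.
apply: measurable_sum => i.
by apply: measurable_funM; [exact: mf|exact: mg].
Qed.

Lemma measurable_hyperplane n (a : n.-tuple R) (s : R) :
  measurable [set x | vec_dot a x = s].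
Proof.
rewrite -[X in measurable X]setTI.
have /(_ measurableT [set s]) := @measurable_vec_dot n _ _ (cst a) id
  (@measurable_cst _ _ _ _ _ _) (@measurable_id _ _ _).
by apply; exact: measurable_set1.
Qed.

(** If some coordinate of [a] beyond the first one is nonzero, every slice with
    a fixed first coordinate is a hyperplane in one dimension less; otherwise
    the hyperplane is a box whose first side is a single point. *)
Lemma lebesgue_vec_hyperplane n (a : n.-tuple R) (s : R) :
  (exists i, tnth a i != 0%R) -> lebesgue_vec R n [set x | vec_dot a x = s] = 0.
Proof.
elim: n => [|n IHn] in a s *; first by move=> -[[]].
move=> [i ai0].
have [|a'0] := pselect (exists j : 'I_n, tnth a (lift ord0 j) != 0%R).
  move=> [j aj0]; rewrite -[X in lebesgue_vec _ _ X]setIT -integral_indic//;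
    last exact: measurable_hyperplane.
  rewrite ge0_integral_lebesgue_vecS//; last first.
    by apply/measurable_EFinP/measurable_indic; exact: measurable_hyperplane.
  apply: integral0_eq => x _.
  pose a' : n.-tuple R := [tuple tnth a (lift ord0 k) | k < n].
  pose s' := (s - tnth a ord0 * x)%R.
  rewrite (eq_integral
    (fun t => (\1_[set t | vec_dot a' t = s'] t)%:E)); last first.
    move=> t _; rewrite !indicE; congr ((nat_of_bool _)%:R%:E).
    apply/idP/idP; rewrite !inE /= /vec_dot big_ord_recl tnth0.
      under eq_bigr do rewrite tnthS.
      under [in X in _ -> X]eq_bigr do rewrite tnth_mktuple.
      by rewrite /s' => <- /=; ring.
    under eq_bigr do rewrite tnth_mktuple.
    under [in X in _ -> X]eq_bigr do rewrite tnthS.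
    by move=> ->; rewrite /s' /=; ring.
  rewrite integral_indic//; last exact: measurable_hyperplane.
  by rewrite setIT; apply: IHn; exists j; rewrite tnth_mktuple.
have a0 : tnth a ord0 != 0%R.
  move: ai0; case: (unliftP ord0 i) => [j ->|->//] aj.
  by exfalso; apply: a'0; exists j.
pose A (k : 'I_n.+1) : set R :=
  if k == ord0 then [set (s / tnth a ord0)%R] else setT.
rewrite (_ : [set x | _] = [set t | forall k, A k (tnth t k)]).
  rewrite lebesgue_vec_box => [|k]; last by rewrite /A; case: ifP.
  by rewrite big_ord_recl /A eqxx lebesgue_measure_set1 mul0e.
have dotE x : vec_dot a x = (tnth a ord0 * tnth x ord0)%R.
  rewrite /vec_dot big_ord_recl big1 ?addr0// => j _.
  suff /eqP -> : tnth a (lift ord0 j) == 0%R by rewrite mul0r.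
  by apply: contrapT => /negP aj; apply: a'0; exists j.
apply/seteqP; split=> x /=; rewrite dotE.
  move=> dx k; rewrite /A; case: eqP => // -> /=.
  by rewrite -dx mulrAC mulfV ?mul1r.
by move=> /(_ ord0); rewrite /A eqxx /= => ->; rewrite mulrCA mulfV ?mulr1.
Qed.

End lebesgue_vec_theory.

(** * Scalar products *)

Lemma vec_dot_ge0 (R : realType) n (x : n.-tuple R) : 0 <= vec_dot x x.
Proof. by apply: sumr_ge0 => i _; rewrite -expr2 sqr_ge0. Qed.

Lemma vec_dot_gt0 (R : realType) n (x : n.-tuple R) :
  (exists i, tnth x i != 0) -> 0 < vec_dot x x.
Proof.
move=> [i xi0]; rewrite /vec_dot (bigD1 i)//=.
rewrite ltr_wpDr ?sumr_ge0// => [j _|]; first by rewrite -expr2 sqr_ge0.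
by rewrite -expr2 lt0r sqr_ge0 sqrf_eq0 xi0.
Qed.

Lemma vec_dot_CauchySchwarz (R : realType) n (x y : n.-tuple R) :
  vec_dot x y ^+ 2 <= vec_dot x x * vec_dot y y.
Proof.
have [[i yi]|y0] := pselect (exists i, tnth y i != 0); last first.
  rewrite [vec_dot x y]big1 => [|i _].
    by rewrite expr0n mulr_ge0 ?vec_dot_ge0.
  have [->|yi] := eqVneq (tnth y i) 0; first by rewrite mulr0.
  by exfalso; apply: y0; exists i.
have k0 : 0 < vec_dot y y by apply: vec_dot_gt0; exists i.
rewrite -(ler_pM2l k0) -subr_ge0.
set k := vec_dot y y; set t := vec_dot x y.
have -> : k * (vec_dot x x * k) - k * t ^+ 2 =
    \sum_(j < n) (k * tnth x j - t * tnth y j) ^+ 2.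
  under eq_bigr => j _.
    rewrite (_ : _ ^+ 2 = k ^+ 2 * (tnth x j * tnth x j) +
      (- 2 * k * t * (tnth x j * tnth y j) +
       t ^+ 2 * (tnth y j * tnth y j))); last by ring.
    over.
  rewrite !big_split/= -!mulr_sumr.
  by rewrite -/(vec_dot x x) -/(vec_dot x y) -/(vec_dot y y) -/t -/k; ring.
by apply: sumr_ge0 => j _; exact: sqr_ge0.
Qed.

Lemma vec_dot_subl (R : realType) n (x y z : n.-tuple R) :
  vec_dot (vec_sub x y) z = vec_dot x z - vec_dot y z.
Proof.
by rewrite /vec_dot -sumrB; apply: eq_bigr => i _; rewrite tnth_mktuple mulrBl.
Qed.

Lemma vec_dotC (R : realType) n (x y : n.-tuple R) : vec_dot x y = vec_dot y x.
Proof. by apply: eq_bigr => i _; rewrite mulrC. Qed.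

Definition sqdist (R : realType) d (x y : d.-tuple R) : R :=
  vec_dot (vec_sub x y) (vec_sub x y).

Lemma measurable_sqdist (R : realType) d d0 (T0 : measurableType d0)
    (f g : T0 -> d.-tuple R) :
  measurable_fun setT f -> measurable_fun setT g ->
  measurable_fun setT (fun z => sqdist (f z) (g z)).
Proof.
by move=> mf mg; apply: measurable_vec_dot; exact: measurable_vec_sub.
Qed.

Lemma sqdist_le (R : realType) d (x y c : d.-tuple R) :
  sqdist x y <= 2 * sqdist x c + 2 * sqdist y c.
Proof.
rewrite /sqdist /vec_dot !mulr_sumr -big_split/=; apply: ler_sum => i _.
rewrite !tnth_mktuple -subr_ge0.
rewrite [leRHS](_ : _ = (tnth x i + tnth y i - 2 * tnth c i) ^+ 2) ?sqr_ge0//.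
by ring.
Qed.

Lemma eucl_norm_sqr (R : realType) d (x : d.-tuple R) :
  eucl_norm x ^+ 2 = vec_dot x x.
Proof.
rewrite /eucl_norm sqr_sqrtr; last by apply: sumr_ge0 => i _; exact: sqr_ge0.
by apply: eq_bigr => i _; rewrite expr2.
Qed.

(** * The overlap of a density with its translate *)

(** [u] and [v] are the densities at the right and left ends of a chord, [t] and
    [t - k] the positions of these ends along the chord, with the centre at 0
    and the unit of length such that the chord has length [k]. *)
Section chord.
Context (R : realType) (a b k t u v : R).
Hypotheses (a0 : 0 <= a) (b0 : 0 <= b) (S0 : 0 < a + b) (k0 : 0 < k)
  (u0 : 0 <= u) (v0 : 0 <= v).

Let m := Num.min (a * u) (b * v).
Let rhs := (a + b) * (u * Num.max t 0 ^+ 2 + v * Num.max (k - t) 0 ^+ 2).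

Let mau : m <= a * u. Proof. by rewrite /m ge_min lexx. Qed.
Let mbv : m <= b * v. Proof. by rewrite /m ge_min lexx orbT. Qed.

Let far_right : k <= t -> (a + b) * u * k ^+ 2 <= rhs.
Proof.
move=> kt; rewrite /rhs max_l ?(le_trans (ltW k0))// max_r ?subr_le0//.
have kt2 : k ^+ 2 <= t ^+ 2.
  by rewrite ler_sqr ?nnegrE ?(ltW k0) ?(le_trans (ltW k0)).
have Su0 : 0 <= (a + b) * u by rewrite mulr_ge0 ?(ltW S0).
by rewrite expr0n/= mulr0 addr0 mulrA ler_wpM2l.
Qed.

Let far_left : t <= 0 -> (a + b) * v * k ^+ 2 <= rhs.
Proof.
move=> t0; rewrite /rhs max_r// max_l ?subr_ge0 ?(le_trans t0 (ltW k0))//.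
have kt2 : k ^+ 2 <= (k - t) ^+ 2.
  rewrite ler_sqr ?lerDl ?oppr_ge0 ?nnegrE ?(ltW k0)//.
  by rewrite subr_ge0 (le_trans t0 (ltW k0)).
have Sv0 : 0 <= (a + b) * v by rewrite mulr_ge0 ?(ltW S0).
by rewrite expr0n/= mulr0 add0r mulrA ler_wpM2l.
Qed.

(** The chord crosses the hyperplane: Cauchy-Schwarz with its remainder, cleared
    of the denominators [a] and [b], which may vanish. *)
Let crossing : 0 < t < k ->
  m * (a * b * k ^+ 2 + ((a + b) * t - a * k) ^+ 2) <= a * b * rhs.
Proof.
move=> /andP[t0 tk]; rewrite /rhs !max_l ?subr_ge0 ?(ltW t0) ?(ltW tk)//.
have -> : a * b * k ^+ 2 + ((a + b) * t - a * k) ^+ 2 =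
  (a + b) * (b * t ^+ 2 + a * (k - t) ^+ 2) by ring.
have -> : a * b * ((a + b) * (u * t ^+ 2 + v * (k - t) ^+ 2)) =
  (a + b) * (a * u * (b * t ^+ 2) + b * v * (a * (k - t) ^+ 2)) by ring.
rewrite mulrCA ler_wpM2l ?(ltW S0)// mulrDr lerD//.
  by rewrite ler_wpM2r// mulr_ge0// sqr_ge0.
by rewrite ler_wpM2r// mulr_ge0// sqr_ge0.
Qed.

Let rhs_ge0 : 0 <= rhs.
Proof. by rewrite mulr_ge0 ?(ltW S0)// addr_ge0// mulr_ge0// sqr_ge0. Qed.

Let m_gt0_factors : 0 < m -> [/\ 0 < a, 0 < b, 0 < u & 0 < v].
Proof.
move=> m0; have := lt_le_trans m0 mau; have := lt_le_trans m0 mbv.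
rewrite !lt0r !mulf_eq0 !negb_or a0 b0 u0 v0 !andbT.
by move=> /andP[/andP[-> ->] _] /andP[/andP[-> ->] _].
Qed.

Let m_ge0 : 0 <= m.
Proof. by rewrite /m le_min !mulr_ge0. Qed.

Lemma chord_le : m * k ^+ 2 <= rhs.
Proof.
have [m0|mN0] := eqVneq m 0; first by rewrite m0 mul0r.
have [a_gt0 b_gt0 _ _] : [/\ 0 < a, 0 < b, 0 < u & 0 < v].
  by apply: m_gt0_factors; rewrite lt0r mN0.
have k2 : 0 <= k ^+ 2 by rewrite sqr_ge0.
have [kt|tk] := leP k t.
  apply: le_trans (far_right kt); rewrite ler_wpM2r// (le_trans mau)//.
  by rewrite ler_wpM2r// lerDl.
have [t0|t0] := leP t 0.
  apply: le_trans (far_left t0); rewrite ler_wpM2r// (le_trans mbv)//.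
  by rewrite ler_wpM2r// lerDr.
have ab_gt0 : 0 < a * b by rewrite mulr_gt0.
rewrite -(ler_pM2l ab_gt0).
have /crossing : 0 < t < k by rewrite t0.
by apply: le_trans; rewrite mulrDr mulrCA lerDl mulr_ge0// sqr_ge0.
Qed.

(** The exceptional position [t = a * k / (a + b)] is the equality case of
    Cauchy-Schwarz. *)
Lemma chord_lt : (a + b) * t != a * k ->
  (0 < u * Num.max t 0) || (0 < v * Num.max (k - t) 0) -> m * k ^+ 2 < rhs.
Proof.
move=> Stak pos.
have rhs_gt0 : 0 < rhs.
  rewrite /rhs mulr_gt0//; case/orP: pos => /[dup] p /gt_eqF/negbT.
    rewrite mulf_eq0 negb_or => /andP[uN0 tN0].
    apply: ltr_wpDr; first by rewrite mulr_ge0 ?sqr_ge0.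
    by rewrite mulr_gt0// lt0r ?sqrf_eq0 ?uN0 ?tN0 ?sqr_ge0.
  rewrite mulf_eq0 negb_or => /andP[uN0 tN0].
  apply: ltr_wpDl; first by rewrite mulr_ge0 ?sqr_ge0.
  by rewrite mulr_gt0// lt0r ?sqrf_eq0 ?uN0 ?tN0 ?sqr_ge0.
have [m0|mN0] := eqVneq m 0; first by rewrite m0 mul0r.
have m_gt0 : 0 < m by rewrite lt0r mN0.
have [a_gt0 b_gt0 u_gt0 v_gt0] := m_gt0_factors m_gt0.
have k2 : 0 < k ^+ 2 by rewrite exprn_gt0.
have [kt|tk] := leP k t.
  apply: lt_le_trans (far_right kt); rewrite ltr_pM2r// (le_lt_trans mau)//.
  by rewrite ltr_pM2r// ltrDl.
have [t0|t0] := leP t 0.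
  apply: lt_le_trans (far_left t0); rewrite ltr_pM2r// (le_lt_trans mbv)//.
  by rewrite ltr_pM2r// ltrDr.
have ab_gt0 : 0 < a * b by rewrite mulr_gt0.
rewrite -(ltr_pM2l ab_gt0).
have /crossing : 0 < t < k by rewrite t0.
apply: lt_le_trans.
rewrite mulrDr mulrCA ltrDl mulr_gt0// lt0r sqr_ge0 andbT sqrf_eq0 subr_eq0.
exact: Stak.
Qed.

End chord.

Lemma half_max_sqr (R : realType) (t : R) :
  Num.max t 0 ^+ 2 + Num.max (- t) 0 ^+ 2 = t ^+ 2.
Proof.
have [t0|t0] := leP t 0.
  by rewrite max_l ?oppr_ge0// expr0n add0r sqrrN.
by rewrite max_r ?oppr_le0 ?ltW// expr0n addr0.
Qed.

Section overlap.
Local Open Scope ereal_scope.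
Context (R : realType) (n : nat).
Local Notation lam := (lebesgue_vec R n).
Variables (p : n.-tuple R -> R) (c h : n.-tuple R) (a b : R).
Hypotheses (mp : measurable_fun setT p) (p0 : forall x, (0 <= p x)%R).
Hypotheses (a0 : (0 <= a)%R) (b0 : (0 <= b)%R) (S0 : (0 < a + b)%R).
Hypothesis (h0 : exists i, tnth h i != 0%R).

Let k := vec_dot h h.
Let t x := vec_dot (vec_sub x c) h.
Let k0 : (0 < k)%R. Proof. exact: vec_dot_gt0. Qed.
Let Sk0 : (0 <= (a + b) / k)%R. Proof. by rewrite divr_ge0 ?ltW. Qed.

Let tsub x : t (vec_sub x h) = (t x - k)%R.
Proof. by rewrite /t !vec_dot_subl /k; ring. Qed.

Let mt : measurable_fun setT t.
Proof. by apply: measurable_vec_dot => //; exact: measurable_vec_sub. Qed.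

Let msh : measurable_fun setT (fun x : n.-tuple R => vec_sub x h).
Proof. exact: measurable_vec_sub. Qed.

(** What the point [x] pays towards the load of a chord: [share 1] if it is the
    right end, [share (-1)] if it is the left end. *)
Let share (s : R) x := ((a + b) / k * (p x * Num.max (s * t x) 0 ^+ 2))%R.

Let mshare s : measurable_fun setT (share s).
Proof.
apply: measurable_funM => //; apply: measurable_funM => //.
by apply: measurable_funX; apply: measurable_maxr => //; exact: measurable_funM.
Qed.

Let share_ge0 s x : (0 <= share s x)%R.
Proof. by rewrite mulr_ge0// mulr_ge0// sqr_ge0. Qed.

(** The mass of the chord ending at [x], times its squared length. *)
Let load x := (Num.min (a * p x) (b * p (vec_sub x h)) * k)%R.

Let mload : measurable_fun setT load.
Proof.
apply: measurable_funM => //.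
apply: measurable_minr; apply: measurable_funM => //.
exact: measurableT_comp.
Qed.

Let load_ge0 x : (0 <= load x)%R.
Proof. by rewrite mulr_ge0 ?(ltW k0)// le_min !mulr_ge0. Qed.

Let charge x := (share 1 x + share (-1)%R (vec_sub x h))%R.

Let mcharge : measurable_fun setT charge.
Proof. by apply: measurable_funD => //; exact: measurableT_comp. Qed.

Let chargeE x : (charge x * k = (a + b) * (p x * Num.max (t x) 0 ^+ 2 +
   p (vec_sub x h) * Num.max (k - t x) 0 ^+ 2))%R.
Proof.
rewrite /charge /share tsub mul1r mulN1r opprB.
by rewrite -mulrDr mulrAC divfK// gt_eqF.
Qed.

Let load_le_charge x : (load x <= charge x)%R.
Proof.
by rewrite -(ler_pM2r k0) chargeE /load -mulrA -expr2; exact: chord_le.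
Qed.

(** Translating the integral of the shares of left ends collects at [x] its two
    shares; only one of them is nonzero, according to the sign of [t x]. *)
Let integral_charge_le :
  \int[lam]_x (charge x)%:E <= \int[lam]_x ((a + b) * (p x * sqdist x c))%:E.
Proof.
have -> : \int[lam]_x (charge x)%:E =
    \int[lam]_x (share 1 x + share (-1)%R x)%:E.
  under eq_integral do rewrite EFinD.
  rewrite ge0_integralD//; last 4 first.
  - by move=> x _; rewrite lee_fin.
  - exact/measurable_EFinP.
  - by move=> x _; rewrite lee_fin.
  - by apply/measurable_EFinP; exact: measurableT_comp.
  rewrite (ge0_integral_vec_translate h
    (f := fun x => (share (-1)%R x)%:E)); last 2 first.
  - exact/measurable_EFinP.
  - by move=> x; rewrite lee_fin.
  rewrite -ge0_integralD//.
  - by move=> x _; rewrite lee_fin.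
  - exact/measurable_EFinP.
  - by move=> x _; rewrite lee_fin.
  - exact/measurable_EFinP.
apply: ge0_le_integral => //.
- by move=> x _; rewrite lee_fin addr_ge0.
- by apply/measurable_EFinP; exact: measurable_funD.
- apply/measurable_EFinP; apply: measurable_funM => //.
  by apply: measurable_funM => //; exact: measurable_sqdist.
- move=> x _; rewrite lee_fin /share mul1r mulN1r -mulrDr -mulrDr half_max_sqr.
  rewrite -[leLHS]mulrA ler_wpM2l ?(ltW S0)// mulrCA ler_wpM2l//.
  by rewrite ler_pdivrMl// mulrC vec_dot_CauchySchwarz.
Qed.

Hypothesis (ip : 0 < \int[lam]_x (p x)%:E).
Hypothesis (ifin : \int[lam]_x (p x * sqdist x c)%:E < +oo).

(** If equality held, almost every point would have two zero shares, by
    [chord_lt]; but a point off the hyperplane [t = 0] at which [p] is positive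
    has a nonzero share. *)
Lemma overlap_lt :
  \int[lam]_x (load x)%:E < \int[lam]_x ((a + b) * (p x * sqdist x c))%:E.
Proof.
rewrite ltNge; apply/negP => VL.
have Vfin : \int[lam]_x ((a + b) * (p x * sqdist x c))%:E < +oo.
  under eq_integral do rewrite EFinM.
  rewrite ge0_integralZl_EFin ?(ltW S0)//.
  - by rewrite lte_mul_pinfty// lee_fin ltW.
  - by move=> x _; rewrite lee_fin mulr_ge0 ?vec_dot_ge0.
  - apply/measurable_EFinP; apply: measurable_funM => //.
    exact: measurable_sqdist.
have aeLR : {ae lam, forall x, load x = charge x}.
  apply: ge0_integral_squeeze_ae => //.
  - by move=> x; rewrite load_ge0 load_le_charge.
  - exact: le_lt_trans Vfin.
  - exact: le_trans VL.
have aeH s : {ae lam, forall x, vec_dot x h != s}.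
  exists [set x | vec_dot h x = s]; split.
  - exact: measurable_hyperplane.
  - exact: lebesgue_vec_hyperplane.
  - by move=> x /= /negP; rewrite negbK vec_dotC => /eqP.
have ae2 : {ae lam, forall x, (p x * Num.max (t x) 0 = 0 /\
    p (vec_sub x h) * Num.max (k - t x) 0 = 0)%R}.
  (* On this hyperplane, (a + b) * t x = a * k. *)
  apply: filterS2 aeLR (aeH (a * k / (a + b) + vec_dot c h)%R) => x LR xH.
  have St : ((a + b) * t x != a * k)%R.
    apply: contra xH => /eqP St; rewrite /t vec_dot_subl in St.
    by rewrite -St [X in (X / _)%R]mulrC mulfK ?(gt_eqF S0)// subrK.
  have p1 : (0 <= p x * Num.max (t x) 0)%R.
    by rewrite mulr_ge0// le_max lexx orbT.
  have p2 : (0 <= p (vec_sub x h) * Num.max (k - t x) 0)%R.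
    by rewrite mulr_ge0// le_max lexx orbT.
  have := chord_lt a0 b0 S0 k0 (p0 x) (p0 (vec_sub x h)) St.
  rewrite -chargeE expr2 mulrA -LR ltxx => charged; split; apply/eqP.
    rewrite eq_le p1 andbT leNgt; apply/negP => q.
    by move: charged; rewrite q => /(_ isT).
  rewrite eq_le p2 andbT leNgt; apply/negP => q.
  by move: charged; rewrite q orbT => /(_ isT).
pose F s x := (p x * Num.max (s * t x) 0)%R.
have mF s : measurable_fun setT (F s).
  apply: measurable_funM => //.
  by apply: measurable_maxr => //; exact: measurable_funM.
have F0 s x : (0 <= F s x)%R by rewrite mulr_ge0// le_max lexx orbT.
have iF1 : \int[lam]_x (F 1 x)%:E = 0.
  apply: ae0_ge0_integral => //.
  by apply: filterS ae2 => x []; rewrite /F mul1r.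
have iFN : \int[lam]_x (F (-1)%R x)%:E = 0.
  rewrite -(ge0_integral_vec_translate h
    (f := fun x => (F (-1)%R x)%:E)); last 2 first.
  - exact/measurable_EFinP.
  - by move=> x; rewrite lee_fin.
  apply: (ae0_ge0_integral (f := fun x => F (-1)%R (vec_sub x h))) => //.
    exact: measurableT_comp.
  by apply: filterS ae2 => x []; rewrite /F tsub mulN1r opprB.
have aep : {ae lam, forall x, p x = 0%R}.
  apply: filterS3 (ge0_integral0_ae (mF _) (F0 _) iF1)
    (ge0_integral0_ae (mF _) (F0 _) iFN) (aeH (vec_dot c h)) => x.
  rewrite /F mul1r mulN1r => H1 H2 xH; apply/eqP; apply: contraT => px0.
  have : (t x = 0)%R.
    move/eqP: H1; move/eqP: H2; rewrite !mulf_eq0 (negbTE px0)/=.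
    have [t0|t0] := leP (t x) 0%R.
      by rewrite max_l ?oppr_ge0// oppr_eq0 => /eqP.
    by rewrite (gt_eqF t0).
  by rewrite /t vec_dot_subl => /eqP; rewrite subr_eq0 (negbTE xH).
by move: ip; rewrite ae0_ge0_integral// ltxx.
Qed.

End overlap.

(** * The mean squared jump *)

Section jump.
Local Open Scope ereal_scope.
Context (R : realType) (d : nat).
Local Notation lam := (lebesgue_vec R d).
Local Notation T := (d.-tuple R).
Variables (target step : T -> R).
Hypotheses (Ht : probability_density target) (Hs : probability_density step).

(** The density of accepted moves from [x] to [y] in the stationary chain. *)
Definition metropolis_flow (x y : T) : R :=
  Num.min (target x * proposal step x y)%R (target y * proposal step y x)%R.

Let mt : measurable_fun setT target. Proof. by case: Ht. Qed.
Let ms : measurable_fun setT step. Proof. by case: Hs. Qed.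
Let t0 x : (0 <= target x)%R. Proof. by case: Ht. Qed.
Let s0 x : (0 <= step x)%R. Proof. by case: Hs. Qed.

Lemma measurable_proposal d0 (T0 : measurableType d0) (f g : T0 -> T) :
  measurable_fun setT f -> measurable_fun setT g ->
  measurable_fun setT (fun z => proposal step (f z) (g z)).
Proof.
by move=> mf mg; apply: (measurableT_comp ms); exact: measurable_vec_sub.
Qed.

Lemma measurable_metropolis_flow d0 (T0 : measurableType d0) (f g : T0 -> T) :
  measurable_fun setT f -> measurable_fun setT g ->
  measurable_fun setT (fun z => metropolis_flow (f z) (g z)).
Proof.
move=> mf mg; apply: measurable_minr; apply: measurable_funM.
- exact: measurableT_comp.
- exact: measurable_proposal.
- exact: measurableT_comp.
- exact: measurable_proposal.
Qed.

Lemma metropolis_flow_ge0 x y : (0 <= metropolis_flow x y)%R.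
Proof. by rewrite /metropolis_flow /proposal le_min !mulr_ge0. Qed.

Lemma metropolis_flowC x y : metropolis_flow x y = metropolis_flow y x.
Proof. by rewrite /metropolis_flow minC. Qed.

Hypothesis d_gt0 : (0 < d)%N.
Variable c : T.
Hypothesis V_fin : \int[lam]_x (target x * sqdist x c)%:E < +oo.

Let z : T := [tuple 0%R | i < d].
Let S h := (step (vec_sub z h) + step h)%R.

Let mS : measurable_fun setT S.
Proof.
apply: measurable_funD => //; apply: (measurableT_comp ms).
exact: measurable_vec_sub.
Qed.

Let S_ge0 h : (0 <= S h)%R. Proof. by rewrite addr_ge0. Qed.

Let integral_S : \int[lam]_h (S h)%:E = 2%:E.
Proof.
under eq_integral do rewrite EFinD.
rewrite ge0_integralD//; last 4 first.
- by move=> x _; rewrite lee_fin.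
- apply/measurable_EFinP; apply: (measurableT_comp ms).
  exact: measurable_vec_sub.
- by move=> x _; rewrite lee_fin.
- exact/measurable_EFinP.
rewrite (ge0_integral_vec_reflect z (f := fun x => (step x)%:E)); last 2 first.
- exact/measurable_EFinP.
- by move=> x; rewrite lee_fin.
by case: Hs => _ _ ->; rewrite -EFinD.
Qed.

Let V := \int[lam]_x (target x * sqdist x c)%:E.

Let V_ge0 : 0 <= V.
Proof.
by apply: integral_ge0 => x _; rewrite lee_fin mulr_ge0// vec_dot_ge0.
Qed.

(** The contribution of the jumps by [- h]. *)
Let A h := \int[lam]_x
  (Num.min (step (vec_sub z h) * target x) (step h * target (vec_sub x h)) *
   vec_dot h h)%:E.

Let fA (p : T * T) : R :=
  (Num.min (step (vec_sub z p.2) * target p.1)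
           (step p.2 * target (vec_sub p.1 p.2)) * vec_dot p.2 p.2)%R.

Let mfA : measurable_fun setT fA.
Proof.
apply: measurable_funM; last exact: measurable_vec_dot.
apply: measurable_minr; apply: measurable_funM.
- by apply: (measurableT_comp ms); exact: measurable_vec_sub.
- exact: measurableT_comp.
- exact: measurableT_comp.
- by apply: (measurableT_comp mt); exact: measurable_vec_sub.
Qed.

Let fA_ge0 p : (0 <= fA p)%R.
Proof. by rewrite mulr_ge0 ?vec_dot_ge0// le_min !mulr_ge0. Qed.

Let jump_slices :
  \int[lam]_x \int[lam]_y (metropolis_flow x y * sqdist x y)%:E =
  \int[lam]_h A h.
Proof.
rewrite -(fubini_tonelli (EFin \o fA)); last 2 first.
- exact/measurable_EFinP.
- by move=> p; rewrite lee_fin.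
apply: eq_integral => x _.
rewrite -(ge0_integral_vec_reflect x); last 2 first.
- apply/measurable_EFinP/measurable_funM.
    exact: measurable_metropolis_flow.
  exact: measurable_sqdist.
- by move=> y; rewrite lee_fin mulr_ge0 ?metropolis_flow_ge0 ?vec_dot_ge0.
apply: eq_integral => h _; congr (_%:E).
rewrite /fA/= /sqdist /metropolis_flow /proposal.
have -> : vec_sub x (vec_sub x h) = h.
  by apply/eq_from_tnth => i; rewrite !tnth_mktuple subKr.
have -> : vec_sub (vec_sub x h) x = vec_sub z h.
  by apply/eq_from_tnth => i; rewrite !tnth_mktuple; ring.
by congr (Num.min _ _ * _)%R; exact: mulrC.
Qed.

Let A_ge0 h : 0 <= A h.
Proof.
by apply: integral_ge0 => x _; rewrite lee_fin; exact: (fA_ge0 (x, h)).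
Qed.

Let mA : measurable_fun setT A.
Proof.
apply: (measurable_fun_fubini_tonelli_G (EFin \o fA)).
- exact/measurable_EFinP.
- by move=> p; rewrite lee_fin.
Qed.

Let SV h : \int[lam]_x (S h * (target x * sqdist x c))%:E = (S h)%:E * V.
Proof.
under eq_integral do rewrite EFinM.
rewrite ge0_integralZl_EFin//.
- by move=> x _; rewrite lee_fin mulr_ge0// vec_dot_ge0.
- by apply/measurable_EFinP/measurable_funM => //; exact: measurable_sqdist.
Qed.

Let A_lt h : (exists i, tnth h i != 0%R) -> (0 < S h)%R -> A h < (S h)%:E * V.
Proof.
move=> h0 Sh; rewrite -SV; apply: overlap_lt => //.
by case: Ht => _ _ ->.
Qed.

Let A_le h : A h <= (S h)%:E * V.
Proof.
have [h0|h0] := pselect (exists i, tnth h i != 0%R); last first.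
  rewrite /A (_ : vec_dot h h = 0%R).
    under eq_integral do rewrite mulr0.
    by rewrite integral0 mule_ge0// lee_fin.
  rewrite /vec_dot big1// => i _; have [->|hi] := eqVneq (tnth h i) 0%R.
    by rewrite mul0r.
  by exfalso; apply: h0; exists i.
have [Sh|Sh] := ltP 0%R (S h); first exact/ltW/A_lt.
have Sh0 : S h = 0%R by apply/eqP; rewrite eq_le Sh S_ge0.
have /andP[/eqP s1 /eqP s2] : (step (vec_sub z h) == 0%R) && (step h == 0%R).
  by rewrite -paddr_eq0// -/(S h) Sh0.
rewrite /A s1 s2; under eq_integral do rewrite !mul0r minxx mul0r.
by rewrite integral0 mule_ge0// lee_fin.
Qed.

(** All slices satisfy the wide inequality, and those with [h <> 0] and
    [S h > 0] the strict one; the latter are not negligible since [S] integrates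
    to 2. *)
Lemma integral_jump_lt :
  \int[lam]_x \int[lam]_y (metropolis_flow x y * sqdist x y)%:E <
  2%:E * \int[lam]_x (target x * sqdist x c)%:E.
Proof.
rewrite jump_slices -/V.
have Vfin : V \is a fin_num by rewrite ge0_fin_numE.
have Afin h : A h \is a fin_num.
  by rewrite ge0_fin_numE// (le_lt_trans (A_le h))// lte_mul_pinfty ?lee_fin.
have iSV : \int[lam]_h ((S h * fine V)%R)%:E = 2%:E * V.
  under eq_integral do rewrite EFinM fineK//.
  rewrite ge0_integralZr ?integral_S//.
  - exact/measurable_EFinP.
  - by move=> x _; rewrite lee_fin.
rewrite -iSV ltNge; apply/negP => iA.
have : {ae lam, forall h, fine (A h) = (S h * fine V)%R}.
  apply: ge0_integral_squeeze_ae.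
  - by apply: measurableT_comp.
  - exact: measurable_funM.
  - move=> h; rewrite fine_ge0//= -lee_fin EFinM !fineK//.
  - by rewrite iSV lte_mul_pinfty.
  - by under [leRHS]eq_integral do rewrite fineK//.
move=> aeA.
(* The vectors with a vanishing first coordinate form a null set. *)
pose e : T := [tuple (i == Ordinal d_gt0)%:R%R | i < d].
have aeh : {ae lam, forall h, exists i, tnth h i != 0%R}.
  exists [set h | vec_dot e h = 0%R]; split.
  - exact: measurable_hyperplane.
  - apply: lebesgue_vec_hyperplane; exists (Ordinal d_gt0).
    by rewrite tnth_mktuple eqxx oner_neq0.
  - move=> h /= h0; rewrite /vec_dot big1// => i _.
    have [->|hi] := eqVneq (tnth h i) 0%R; first by rewrite mulr0.
    by exfalso; apply: h0; exists i.
have aeS : {ae lam, forall h, S h = 0%R}.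
  apply: filterS2 aeA aeh => h Ah h0; apply/eqP.
  rewrite eq_le S_ge0 andbT leNgt.
  apply/negP => /(A_lt h0); rewrite -[ltRHS]fineK ?fin_numM// -[ltLHS]fineK//.
  by rewrite lte_fin Ah fineM//= ltxx.
have := integral_S; rewrite ae0_ge0_integral// => /eqP.
by rewrite eqe lt_eqF.
Qed.

End jump.

(** * The joint law of two consecutive states *)

Section joint_law.
Local Open Scope ereal_scope.
Context (R : realType) (d : nat).
Local Notation lam := (lebesgue_vec R d).
Local Notation T := (d.-tuple R).
Variables (target step : T -> R).
Hypotheses (Ht : probability_density target) (Hs : probability_density step).
Local Notation flow := (metropolis_flow target step).

Let mt : measurable_fun setT target. Proof. by case: Ht. Qed.
Let t0 x : (0 <= target x)%R. Proof. by case: Ht. Qed.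
Let s0 x : (0 <= step x)%R. Proof. by case: Hs. Qed.

(** This holds also when the denominator of the acceptance ratio vanishes, both
    sides being then zero. *)
Lemma target_proposal_acceptance x y :
  (target x * proposal step x y * acceptance target step x y)%R = flow x y.
Proof.
rewrite /acceptance /proposal.
have tp0 x' y' : (0 <= target x' * proposal step x' y')%R.
  by rewrite mulr_ge0 ?s0.
case: ifPn => [pos|]; last first.
  rewrite -leNgt => np; have /eqP tp : (target x * proposal step x y == 0)%R.
    by rewrite eq_le np tp0.
  by rewrite tp mul0r /metropolis_flow tp min_l.
rewrite minr_pMr ?tp0// mulr1 mulrCA mulfV ?mulr1//.
by rewrite gt_eqF.
Qed.

Definition rejected_flow x y := (target x * proposal step x y - flow x y)%R.

Local Notation stay := rejected_flow.

Lemma rejected_flow_ge0 x y : (0 <= rejected_flow x y)%R.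
Proof. by rewrite subr_ge0 /metropolis_flow ge_min lexx. Qed.

Lemma measurable_rejected_flow d0 (T0 : measurableType d0) (f g : T0 -> T) :
  measurable_fun setT f -> measurable_fun setT g ->
  measurable_fun setT (fun z => stay (f z) (g z)).
Proof.
move=> mf mg; apply: measurable_funB; last exact: measurable_metropolis_flow.
by apply: measurable_funM; [exact: measurableT_comp|exact: measurable_proposal].
Qed.

Lemma integral_proposal x : \int[lam]_y (proposal step x y)%:E = 1.
Proof.
rewrite (ge0_integral_vec_translate x (f := fun y => (step y)%:E)).
- by case: Hs.
- by apply/measurable_EFinP; case: Hs.
- by move=> y; rewrite lee_fin.
Qed.

Lemma ge0_integral_target_proposal (g : T -> \bar R) :
  measurable_fun setT g -> (forall x, 0 <= g x) ->
  \int[lam \x lam]_p (g p.1 * (target p.1 * proposal step p.1 p.2)%:E) =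
  \int[lam]_x (g x * (target x)%:E).
Proof.
move=> mg g0; rewrite fubini_tonelli1; last 2 first.
- apply: emeasurable_funM; first exact: measurableT_comp.
  apply/measurable_EFinP/measurable_funM; first exact: measurableT_comp.
  exact: measurable_proposal.
- by move=> p; rewrite mule_ge0// lee_fin mulr_ge0 ?s0.
apply: eq_integral => x _; rewrite /fubini_F/=.
under eq_integral do rewrite EFinM muleA.
rewrite ge0_integralZl//.
- by rewrite integral_proposal mule1.
- by apply/measurable_EFinP; exact: measurable_proposal.
- by move=> y _; rewrite lee_fin s0.
- by rewrite mule_ge0 ?lee_fin.
Qed.

Variables (dO : measure_display) (Omega : measurableType dO)
  (P : probability Omega R) (X : nat -> {RV P >-> T}).
Hypothesis chain : stationary_rwmh target step X.

Let mflow : measurable_fun setT (fun p : T * T => flow p.1 p.2).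
Proof. exact: measurable_metropolis_flow. Qed.

Let mstay : measurable_fun setT (fun p : T * T => stay p.1 p.2).
Proof. exact: measurable_rejected_flow. Qed.

Let flow0 (p : T * T) : (0 <= flow p.1 p.2)%R.
Proof. exact: metropolis_flow_ge0. Qed.

Let stay0 (p : T * T) : (0 <= stay p.1 p.2)%R.
Proof. exact: rejected_flow_ge0. Qed.

Let diag (p : T * T) := (p.1, p.1).

Let mdiag : measurable_fun setT diag.
Proof. exact: measurable_fun_pair. Qed.

Lemma ge0_integral_X0 D (g : T -> \bar R) : measurable D ->
  measurable_fun D g -> (forall x, 0 <= g x) ->
  \int[P]_(w in X 0%N @^-1` D) g (X 0%N w) =
  \int[lam]_(x in D) (g x * (target x)%:E).
Proof.
move=> mD mg g0.
rewrite -(ge0_integral_pushforward (measurable_funPT (X 0%N)) P mD mg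
  (fun x _ => g0 x)).
rewrite -(ge0_integral_mdensity lam mt t0 mD mg g0).
by apply: eq_measure_integral => A mA _; exact: (proj1 chain).
Qed.

Let Z : Omega -> T * T := fun w => (X 0%N w, X 1%N w).
Let mZ : measurable_fun setT Z.
Proof. exact: measurable_fun_pair. Qed.

(** Accepted moves are distributed according to [flow], and rejected ones stay
    on the diagonal. *)
Let nu : {measure set (T * T) -> \bar R} :=
  measure_add (mdensity (lam \x lam) mflow flow0)
    (measure_function_pushforward__canonical__measure_function_Measure
      (mdensity (lam \x lam) mstay stay0) mdiag).

Lemma acceptance_itv x y : (0 <= acceptance target step x y <= 1)%R.
Proof.
rewrite /acceptance; case: ifP => _; last by rewrite ler01 lexx.
by rewrite ge_min lexx le_min ler01 divr_ge0 ?mulr_ge0// s0.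
Qed.

Lemma measurable_acceptance d0 (T0 : measurableType d0) (f g : T0 -> T) :
  measurable_fun setT f -> measurable_fun setT g ->
  measurable_fun setT (fun z => acceptance target step (f z) (g z)).
Proof.
move=> mf mg.
have mtp (f' g' : T0 -> T) : measurable_fun setT f' -> measurable_fun setT g' ->
    measurable_fun setT
      (fun z => target (f' z) * proposal step (f' z) (g' z))%R.
  move=> mf' mg'; apply: measurable_funM; first exact: measurableT_comp.
  exact: measurable_proposal.
(* The denominator is nonnegative, so its inverse is a real power of it. *)
rewrite (_ : (fun z => _) = (fun z =>
    if 0 < target (f z) * proposal step (f z) (g z) then
      Num.min 1 (target (g z) * proposal step (g z) (f z) *
        (target (f z) * proposal step (f z) (g z)) `^ (- 1))
    else 1)%R); last first.
  by apply/funext => z; rewrite /acceptance powR_inv1// mulr_ge0 ?s0.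
apply: measurable_fun_ifT => //.
- by apply: measurable_fun_ltr => //; exact: mtp.
- apply: measurable_minr => //; apply: measurable_funM; first exact: mtp.
  by apply: (measurableT_comp (measurable_powR _)); exact: mtp.
Qed.

Let kernel_density B (p : T * T) : R :=
  (proposal step p.1 p.2 * (acceptance target step p.1 p.2 * \1_B p.2 +
    (1 - acceptance target step p.1 p.2) * \1_B p.1))%R.

Let kernel_density_ge0 B p : (0 <= kernel_density B p)%R.
Proof.
have /andP[a0 a1] := acceptance_itv p.1 p.2.
by rewrite mulr_ge0 ?s0// addr_ge0// mulr_ge0// subr_ge0.
Qed.

Let measurable_kernel_density B : measurable B ->
  measurable_fun setT (kernel_density B).
Proof.
move=> mB; have macc := measurable_acceptance measurable_fst measurable_snd.
have m1 : measurable_fun setT (\1_B : T -> R) by exact: measurable_indic.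
apply: measurable_funM; first exact: measurable_proposal.
apply: measurable_funD; apply: measurable_funM => //.
- exact: measurableT_comp.
- exact: measurable_funB.
- exact: measurableT_comp.
Qed.

Lemma measurable_rwmh_kernel B : measurable B ->
  measurable_fun setT (fun x => rwmh_kernel target step x B).
Proof.
move=> mB; apply: (measurable_fun_fubini_tonelli_F (EFin \o kernel_density B)).
- by apply/measurable_EFinP; exact: measurable_kernel_density.
- by move=> p; rewrite lee_fin.
Qed.

Lemma rwmh_kernel_ge0 x B : 0 <= rwmh_kernel target step x B.
Proof.
apply: integral_ge0 => y _; rewrite lee_fin.
exact: (kernel_density_ge0 B (x, y)).
Qed.

Lemma target_rwmh_kernel x B : measurable B ->
  rwmh_kernel target step x B * (target x)%:E =
  \int[lam]_y (flow x y * \1_B y + stay x y * \1_B x)%:E.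
Proof.
move=> mB; rewrite muleC -ge0_integralZl//.
- apply: eq_integral => y _; rewrite -EFinM; congr (_%:E).
  by rewrite /rejected_flow -target_proposal_acceptance; ring.
- apply/measurable_EFinP.
  exact: (measurableT_comp (measurable_kernel_density mB) (pair1_measurable x)).
- by move=> y _; rewrite lee_fin; exact: (kernel_density_ge0 B (x, y)).
- by rewrite lee_fin.
Qed.

Let joint_rect A B : measurable A -> measurable B ->
  pushforward P Z (A `*` B) = nu (A `*` B).
Proof.
move=> mA mB.
have m1 C : measurable C -> measurable_fun setT (\1_C : T -> R).
  by move=> mC; exact: measurable_indic.
have mflowAB : measurable_fun setT
    (fun p : T * T => flow p.1 p.2 * \1_(A `*` B) p)%R.
  apply: measurable_funM => //.
  by apply: measurable_indic; exact: measurableX.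
have mstayAB : measurable_fun setT
    (fun p : T * T => stay p.1 p.2 * \1_(A `*` B) (diag p))%R.
  apply: measurable_funM => //; apply: (measurableT_comp _ mdiag).
  by apply: measurable_indic; exact: measurableX.
have -> : pushforward P Z (A `*` B) = P (X 0%N @^-1` A `&` X 1%N @^-1` B) by [].
rewrite (proj2 chain 0%N)//; last first.
  by apply: sub_sigma_algebra; rewrite big_ord1; exists A => //; rewrite setTI.
rewrite (ge0_integral_X0
  (g := fun x => rwmh_kernel target step x B))//; last 2 first.
- exact: measurable_funTS (measurable_rwmh_kernel mB).
- by move=> x; exact: rwmh_kernel_ge0.
have -> : nu (A `*` B) =
    \int[lam \x lam]_(p in A `*` B) (flow p.1 p.2)%:E +
    \int[lam \x lam]_(p in diag @^-1` (A `*` B)) (stay p.1 p.2)%:E.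
  exact: measure_addE.
rewrite integral_indic_mul.
rewrite [in X in _ = X + _]integral_indic_mul.
rewrite [in X in _ = _ + X]integral_indic_mul.
rewrite -ge0_integralD//; last 4 first.
- by move=> p _; rewrite mule_ge0// lee_fin.
- exact/measurable_EFinP.
- by move=> p _; rewrite mule_ge0// lee_fin.
- exact/measurable_EFinP.
rewrite fubini_tonelli1; last 2 first.
- by apply: emeasurable_funD; exact/measurable_EFinP.
- by move=> p; rewrite adde_ge0// mule_ge0// lee_fin.
apply: eq_integral => x _; rewrite /fubini_F target_rwmh_kernel// muleC.
rewrite -ge0_integralZl//.
- apply: eq_integral => y _; rewrite -!EFinM -EFinD; congr (_%:E).
  rewrite /diag/= -[\1_(diag @^-1` _) _]/(\1_(A `*` B) (x, x)).
  have indicX y' : \1_(A `*` B) (x, y') = (\1_A x * \1_B y' :> R)%R.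
    by rewrite !indicE in_setX/= -mulnb natrM.
  rewrite !indicX; ring.
- apply/measurable_EFinP/measurable_funD; apply: measurable_funM => //.
  + exact: measurable_metropolis_flow.
  + exact: measurable_rejected_flow.
- move=> y _; rewrite lee_fin addr_ge0// mulr_ge0//.
    exact: metropolis_flow_ge0.
  exact: rejected_flow_ge0.
Qed.

(** The two measures agree on rectangles, by the Markov property. *)
Lemma ge0_integral_joint (g : T * T -> \bar R) :
  measurable_fun setT g -> (forall p, 0 <= g p) ->
  \int[P]_w g (X 0%N w, X 1%N w) =
  \int[lam \x lam]_p (g p * (flow p.1 p.2)%:E) +
  \int[lam \x lam]_p (g (p.1, p.1) * (stay p.1 p.2)%:E).
Proof.
move=> mg g0.
transitivity (\int[pushforward P Z]_p g p).
  by rewrite (ge0_integral_pushforward mZ)// => p _; exact: g0.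
transitivity (\int[nu]_p g p).
  apply: eq_measure_integral => A mA _.
  apply: finite_measure_eq_rect => //.
    by rewrite /= /pushforward preimage_setT probability_setT ltry.
rewrite ge0_integral_measure_add//; congr (_ + _).
  by rewrite ge0_integral_mdensity.
rewrite (ge0_integral_pushforward mdiag)//.
rewrite preimage_setT ge0_integral_mdensity//.
- exact: measurableT_comp.
- by move=> p; exact: g0.
Qed.

(** The chain is reversible: [flow] is symmetric, so integrating over the second
    variable is integrating over the first one. *)
Lemma ge0_integral_X1 (g : T -> \bar R) :
  measurable_fun setT g -> (forall x, 0 <= g x) ->
  \int[P]_w g (X 1%N w) = \int[P]_w g (X 0%N w).
Proof.
move=> mg g0.
have m1 : measurable_fun setT (fun p : T * T => g p.1).
  exact: measurableT_comp.
have m2 : measurable_fun setT (fun p : T * T => g p.2).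
  exact: measurableT_comp.
have mgf (h : T * T -> T) : measurable_fun setT h ->
    measurable_fun setT (fun p : T * T => g (h p) * (flow p.1 p.2)%:E).
  move=> mh; apply: emeasurable_funM; last exact/measurable_EFinP.
  exact: measurableT_comp.
have gf0 (h : T * T -> T) p : 0 <= g (h p) * (flow p.1 p.2)%:E.
  by rewrite mule_ge0// lee_fin metropolis_flow_ge0.
have mgs : measurable_fun setT (fun p : T * T => g p.1 * (stay p.1 p.2)%:E).
  by apply: emeasurable_funM => //; exact/measurable_EFinP.
have gs0 (p : T * T) : 0 <= g p.1 * (stay p.1 p.2)%:E.
  by rewrite mule_ge0// lee_fin rejected_flow_ge0.
rewrite (ge0_integral_joint (g := fun p => g p.2))//=.
have -> : \int[lam \x lam]_p (g p.2 * (flow p.1 p.2)%:E) =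
    \int[lam \x lam]_p (g p.1 * (flow p.1 p.2)%:E).
  rewrite (fubini_tonelli1 _ (mgf _ measurable_fst) (gf0 fst)).
  rewrite (fubini_tonelli2 _ (mgf _ measurable_snd) (gf0 snd)).
  apply: eq_integral => x _; apply: eq_integral => y _ /=.
  by rewrite metropolis_flowC.
rewrite -(ge0_integralD (lam \x lam) measurableT (fun p _ => gf0 fst p)
  (mgf _ measurable_fst) (fun p _ => gs0 p) mgs).
have := ge0_integral_X0 measurableT mg g0.
rewrite preimage_setT => ->.
rewrite -(ge0_integral_target_proposal mg g0).
apply: eq_integral => p _.
rewrite -ge0_muleDr ?lee_fin ?metropolis_flow_ge0 ?rejected_flow_ge0//.
by rewrite -EFinD /rejected_flow addrC subrK.
Qed.

Lemma expectation_coord_X1 (i : 'I_d) :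
  'E_P[Defs.coord (X 1%N) i] = 'E_P[Defs.coord (X 0%N) i].
Proof.
rewrite unlock integralE [RHS]integralE.
have mi : measurable_fun setT (fun x : T => (tnth x i)%:E).
  by apply/measurable_EFinP; exact: measurable_tnth.
pose f (x : T) := (tnth x i)%:E.
have posE s : \int[P]_w (fun w => (Defs.coord (X s) i w)%:E)^\+ w =
    \int[P]_w f^\+ (X s w).
  by apply: eq_integral => w _; rewrite !funeposE.
have negE s : \int[P]_w (fun w => (Defs.coord (X s) i w)%:E)^\- w =
    \int[P]_w f^\- (X s w).
  by apply: eq_integral => w _; rewrite !funenegE.
rewrite !posE !negE; congr (_ - _).
- exact: (ge0_integral_X1 (measurable_funepos mi) (fun x => funepos_ge0 _ x)).
- exact: (ge0_integral_X1 (measurable_funeneg mi) (fun x => funeneg_ge0 _ x)).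
Qed.

(** A rejected move does not change the state, hence the absence of [stay]. *)
Lemma expectation_sqdist_X0_X1 :
  \int[P]_w (sqdist (X 0%N w) (X 1%N w))%:E =
  \int[lam]_x \int[lam]_y (flow x y * sqdist x y)%:E.
Proof.
have msq : measurable_fun setT (fun p : T * T => sqdist p.1 p.2).
  exact: measurable_sqdist.
rewrite (ge0_integral_joint
  (g := fun p => (sqdist p.1 p.2)%:E)); last 2 first.
- exact/measurable_EFinP.
- by move=> p; rewrite lee_fin vec_dot_ge0.
rewrite [X in _ + X]integral0_eq ?adde0; last first.
  move=> p _; rewrite /sqdist/= [vec_dot _ _]big1 ?mul0e// => i _.
  by rewrite tnth_mktuple subrr mul0r.
rewrite fubini_tonelli1.
- apply: eq_integral => x _; apply: eq_integral => y _ /=.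
  by rewrite -EFinM mulrC.
- by apply: emeasurable_funM; exact/measurable_EFinP.
- by move=> p; rewrite mule_ge0// lee_fin ?vec_dot_ge0 ?metropolis_flow_ge0.
Qed.

End joint_law.

(** * Trace covariances *)

Section trace_covariance.
Local Open Scope ereal_scope.
Context (R : realType) (d : nat) (dO : measure_display)
  (Omega : measurableType dO) (P : probability Omega R).
Implicit Types Y : {RV P >-> d.-tuple R}.

Lemma integrable_sqdist Y (c : d.-tuple R) : square_integrable Y ->
  P.-integrable setT (fun w => (sqdist (Y w) c)%:E).
Proof.
rewrite /square_integrable unlock => Yfin.
pose z : d.-tuple R := [tuple 0%R | i < d].
have sqz x : sqdist x z = (eucl_norm x ^+ 2)%R.
  rewrite eucl_norm_sqr; apply: eq_bigr => i _.
  by rewrite !tnth_mktuple subr0.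
have mY : measurable_fun setT Y by exact: measurable_funPT.
have mYz : measurable_fun setT (fun w => sqdist (Y w) z).
  exact: measurable_sqdist.
have iYz : P.-integrable setT (fun w => (sqdist (Y w) z)%:E).
  apply/integrableP; split; first exact/measurable_EFinP.
  under eq_integral do rewrite gee0_abs ?lee_fin ?vec_dot_ge0// sqz.
  exact: Yfin.
have : P.-integrable setT
    (fun w => 2%:E * (sqdist (Y w) z)%:E + (2 * sqdist c z)%:E).
  apply: integrableD => //; first exact: integrableZl.
  exact: finite_measure_integrable_cst.
apply: le_integrable => //.
- by apply/measurable_EFinP; exact: measurable_sqdist.
- move=> w _; rewrite -EFinM -EFinD lee_fin ger0_norm ?vec_dot_ge0//.
  by rewrite (le_trans (sqdist_le _ _ z))// ler_norm.
Qed.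

Definition mean Y : d.-tuple R := [tuple fine 'E_P[Defs.coord Y i] | i < d].

Lemma trCovE Y Y' : square_integrable Y -> square_integrable Y' ->
  trCov Y Y' =
  \int[P]_w (vec_dot (vec_sub (Y w) (mean Y)) (vec_sub (Y' w) (mean Y')))%:E.
Proof.
move=> Y2 Y2'.
pose D i w := (tnth (vec_sub (Y w) (mean Y)) i *
  tnth (vec_sub (Y' w) (mean Y')) i)%R.
have mc (Z : {RV P >-> d.-tuple R}) i :
    measurable_fun setT (fun w => tnth (vec_sub (Z w) (mean Z)) i : R).
  apply: (measurableT_comp (measurable_tnth i)).
  by apply: measurable_vec_sub => //; exact: measurable_funPT.
have sqr_le (x : d.-tuple R) i : (tnth x i ^+ 2 <= vec_dot x x)%R.
  rewrite /vec_dot (bigD1 i)//= -expr2 lerDl.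
  by apply: sumr_ge0 => j _; rewrite -expr2 sqr_ge0.
have normM_le (u v : R) : (`|u * v| <= u ^+ 2 + v ^+ 2)%R.
  by rewrite ler_norml; apply/andP; split; nra.
have iD i : P.-integrable setT (fun w => (D i w)%:E).
  have := integrableD measurableT (integrable_sqdist (mean Y) Y2)
    (integrable_sqdist (mean Y') Y2').
  apply: le_integrable => //.
  - by apply/measurable_EFinP; exact: measurable_funM.
  - move=> w _; rewrite -EFinD lee_fin.
    rewrite [leRHS]ger0_norm ?addr_ge0 ?vec_dot_ge0//.
    apply: le_trans (lerD (sqr_le _ i) (sqr_le _ i)).
    exact: normM_le.
transitivity (\sum_(i < d) \int[P]_w (D i w)%:E).
  apply: eq_bigr => i _; rewrite covariance.unlock expectation.unlock.
  apply: eq_integral => w _; congr (_%:E); rewrite /D !tnth_mktuple/=.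
  by rewrite expectation.unlock.
rewrite -integral_sum//.
by apply: eq_integral => w _; rewrite sumEFin.
Qed.

End trace_covariance.

(** * Positivity of the trace correlation *)

Theorem corollary2p5 (R : realType) (d : nat) (d_gt0 : (0 < d)%N)
    (target step : d.-tuple R -> R)
    (target_density : probability_density target)
    (step_density : probability_density step)
    (dO : measure_display) (Omega : measurableType dO)
    (P : probability Omega R) (X : nat -> {RV P >-> d.-tuple R})
    (X_chain : stationary_rwmh target step X)
    (X0_L2 : square_integrable (X 0%N)) :
  0 < trCorr (X 0%N) (X 1%N).
Proof.
pose c := mean (X 0%N).
have mean_X1 : mean (X 1%N) = c.
  apply/eq_from_tnth => i; rewrite !tnth_mktuple.
  by rewrite (expectation_coord_X1 target_density step_density X_chain).
have msq : measurable_fun setT (fun x : d.-tuple R => (sqdist x c)%:E).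
  by apply/measurable_EFinP; exact: measurable_sqdist.
have sq0 x : (0%R <= (sqdist x c)%:E)%E by rewrite lee_fin vec_dot_ge0.
have X1_L2 : square_integrable (X 1%N).
  move: X0_L2; rewrite /square_integrable !expectation.unlock.
  pose g (x : d.-tuple R) := (eucl_norm x ^+ 2)%:E.
  rewrite -[X in (X < _)%E -> _](ge0_integral_X1 target_density step_density
    X_chain (g := g)) //.
    apply/measurable_EFinP; under eq_fun do rewrite eucl_norm_sqr.
    exact: measurable_vec_dot.
  by move=> x; rewrite lee_fin sqr_ge0.
pose V := (\int[P]_w (sqdist (X 0%N w) c)%:E)%E.
have var0 : trVar (X 0%N) = V by rewrite /trVar trCovE.
have var1 : trVar (X 1%N) = V.
  rewrite /trVar trCovE// mean_X1.
  exact: (ge0_integral_X1 target_density step_density X_chain msq sq0).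
have i0 := integrable_sqdist c X0_L2.
have i1 := integrable_sqdist c X1_L2.
have V_fin : V \is a fin_num by exact: integrable_fin_num.
pose M := (\int[P]_w (sqdist (X 0%N w) (X 1%N w))%:E)%E.
have M_lt : (M < 2%:E * V)%E.
  rewrite /M (expectation_sqdist_X0_X1 target_density step_density X_chain).
  have VE : V = (\int[lebesgue_vec R d]_x (target x * sqdist x c)%:E)%E.
    have := ge0_integral_X0 target_density X_chain measurableT msq sq0.
    rewrite preimage_setT /V => ->.
    by apply: eq_integral => x _; rewrite -EFinM mulrC.
  rewrite VE; apply: integral_jump_lt => //.
  by rewrite -VE; move: V_fin; rewrite ge0_fin_numE// integral_ge0.
have M_ge0 : (0 <= M)%E.
  by apply: integral_ge0 => w _; rewrite lee_fin vec_dot_ge0.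
pose D w := vec_dot (vec_sub (X 0%N w) c) (vec_sub (X 1%N w) c).
have mX s : measurable_fun setT (X s) by exact: measurable_funPT.
have iM : P.-integrable setT (fun w => (sqdist (X 0%N w) (X 1%N w))%:E).
  apply/integrableP; split.
    by apply/measurable_EFinP; exact: measurable_sqdist.
  under eq_integral do rewrite gee0_abs ?lee_fin ?vec_dot_ge0//.
  rewrite (lt_trans M_lt)// -ge0_fin_numE ?fin_numM//.
  by rewrite mule_ge0 ?integral_ge0.
have polar w : (2 * D w + sqdist (X 0%N w) (X 1%N w) =
    sqdist (X 0%N w) c + sqdist (X 1%N w) c)%R.
  rewrite /D /sqdist /vec_dot mulr_sumr -!big_split/=; apply: eq_bigr => i _.
  by rewrite !tnth_mktuple; ring.
have iD : P.-integrable setT (fun w => (D w)%:E).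
  have := integrableZl measurableT 2^-1
    (integrableB measurableT (integrableD measurableT i0 i1) iM).
  apply: eq_integrable => // w _ /=.
  by rewrite -!EFinD -EFinM; congr (_%:E); rewrite -polar; field.
have covE : trCov (X 0%N) (X 1%N) = (\int[P]_w (D w)%:E)%E.
  by rewrite trCovE// mean_X1.
have cov_fin : trCov (X 0%N) (X 1%N) \is a fin_num.
  by rewrite covE; exact: integrable_fin_num.
have covV : (2%:E * trCov (X 0%N) (X 1%N) + M = 2%:E * V)%E.
  rewrite covE -integralZl// -integralD//; last exact: integrableZl.
  transitivity
    (\int[P]_w ((sqdist (X 0%N w) c)%:E + (sqdist (X 1%N w) c)%:E))%E.
    by apply: eq_integral => w _; rewrite -EFinM -!EFinD polar.
  rewrite integralD// (ge0_integral_X1 target_density step_density X_chain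
    (g := fun x => (sqdist x c)%:E))//.
  rewrite -/V -(fineK V_fin) -EFinD -EFinM.
  by congr (_%:E); ring.
have M_fin : M \is a fin_num by rewrite ge0_fin_numE// (lt_le_trans M_lt) ?leey.
move: covV M_lt M_ge0; rewrite /trCorr var0 var1.
rewrite -(fineK M_fin) -(fineK V_fin) -(fineK cov_fin) -!EFinM -EFinD.
move=> [] covV; rewrite lte_fin lee_fin /= => M_lt M_ge0.
have V_gt0 : 0 < fine V by lra.
have cov_gt0 : 0 < fine (trCov (X 0%N) (X 1%N)) by lra.
by rewrite divr_gt0// mulr_gt0// sqrtr_gt0.
Qed.
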